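(* Let $(g,m_0,m_1)$ be one of the following triples: $$(2,m_0,m_1),\ (3,1,1),\ (3,2,2),\ (3,4,4),\ (3,8,8),\ (4,m_0,1),\ (4,2,2),\ (6,1,1),\ (6,2,2),$$ where $m_0,m_1$ denote positive integers, and consider an isometric cohomogeneity one action with data $(g,m_0,m_1)$ on the round unit sphere $\mathbb{S}^{\frac{g(m_0+m_1)}{2}+1}$. Then the identity map of $\mathbb{S}^{\frac{g(m_0+m_1)}{2}+1}$ is a stable harmonic map with respect to equivariant variations, i.e. $\delta^2E(r)(\xi,\xi)>0$ for $r(t)=t$ and every equivariant variation $\xi\not\equiv 0$.
   Context: Data of the action: let a compact Lie group $G$ act isometrically with cohomogeneity one on the round unit sphere $\mathbb{S}^{n+1}$. The principal orbits are isoparametric hypersurfaces; $g$ denotes the number of their distinct principal curvatures, and the multiplicities $m_0,\dots,m_{g-1}$ satisfy $m_i=m_0$ for $i$ even and $m_i=m_1$ for $i$ odd, so that $n=\frac{g(m_0+m_1)}{2}$. The orbit space is isometric to $[0,\pi/g]$. Let $\gamma$ be a unit speed normal geodesic (perpendicular to all orbits) with $\gamma(0)$ in a non-principal orbit. Equivariant maps: for a function $r$ on $[0,\pi/g]$ with $r(0)=0$ and $r(\pi/g)=k\pi/g$, $k\in\mathbb{Z}$, one considers the map $a\cdot\gamma(t)\mapsto a\cdot\gamma(r(t))$, $a\in G$. The identity map corresponds to $r(t)=t$ ($k=1$). The energy $\int|d\phi|^2\,dV$ of such a map is $$E(r)=c\int_0^{\pi/g}\Big(\dot r(t)^2+\sum_{i=0}^{g-1}m_i\,\frac{\sin^2(r(t)-i\frac{\pi}{g})}{\sin^2(t-i\frac{\pi}{g})}\Big)\prod_{i=0}^{g-1}\big|\sin(t-i\tfrac{\pi}{g})\big|^{m_i}\,dt,$$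 with a positive constant $c$. Equivariant stability: equivariant variations of $r$ are given by $r+s\xi$ with $\xi$ a smooth function on $[0,\pi/g]$ satisfying $\xi(0)=\xi(\pi/g)=0$, and $\delta^2E(r)(\xi,\xi)=\frac{d^2}{ds^2}\big|_{s=0}E(r+s\xi)$. A harmonic map of the form $a\cdot\gamma(t)\mapsto a\cdot\gamma(r(t))$, $a\in G$, with $r$ a function on $[0,\pi/g]$ satisfying $r(0)=0$ and $r(\pi/g)=k\pi/g$, $k\in\mathbb{Z}$, is called stable with respect to equivariant variations (equivariantly stable) if $\delta^2E(r)(\xi,\xi)>0$ for all such $\xi\not\equiv 0$; equivalently, all eigenvalues of the associated Jacobi operator are positive. *)

(* Defs.v *)
From HB Require Import structures.
From mathcomp Require Import all_boot all_order all_algebra.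
From mathcomp Require Import all_classical all_reals all_analysis.

Set Implicit Arguments.
Unset Strict Implicit.
Unset Printing Implicit Defensive.

Import Order.TTheory GRing.Theory Num.Theory.
Import numFieldNormedType.Exports.

Local Open Scope classical_set_scope.
Local Open Scope ring_scope.

Definition admissible_triple (g m0 m1 : nat) : Prop :=
  [/\ (0 < m0)%N, (0 < m1)%N &
      g = 2%N \/ (g = 4%N /\ m1 = 1%N) \/
      (g, m0, m1) \in [:: (3, 1, 1); (3, 2, 2); (3, 4, 4); (3, 8, 8);
                          (4, 2, 2); (6, 1, 1); (6, 2, 2)]%N].

Definition mult (m0 m1 i : nat) : nat := if odd i then m1 else m0.

(* The dimension n of the principal orbits; the sphere has dimension n + 1 and
   sits in R^(n + 2). *)
Definition orbit_dim (g m0 m1 : nat) : nat := ((g * (m0 + m1))./2)%N.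

Section Sphere.
Variables (R : realType) (n : nat).
Local Notation V := 'cV[R]_n.+2.

Definition dot (u v : V) : R := \sum_i u i ord0 * v i ord0.

Definition sphere : set V := [set x | dot x x = 1].

(* For x and e orthonormal: the unit speed geodesic of the sphere starting at x
   with velocity e. Its velocity at t is [great_circle e (- x) t]. *)
Definition great_circle (x e : V) (t : R) : V := cos t *: x + sin t *: e.

Definition has_dim (S : set V) (d : nat) : Prop :=
  exists U : {vspace V}, (forall u, S u <-> u \in U) /\ \dim U = d.

Fixpoint iter_derive (vs : seq V) (f : V -> V) : V -> V :=
  if vs is v :: vs' then fun x => 'D_v (iter_derive vs' f) x else f.

Definition smooth_map (f : V -> V) : Prop :=
  forall vs x, differentiable (iter_derive vs f) x.

(* A map on the sphere, a closed submanifold, is smooth iff it extends smoothly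
   to the ambient space. *)
Definition smooth_on_sphere (phi : V -> V) : Prop :=
  exists2 f, smooth_map f & {in sphere, phi =1 f}.

Definition tangential (y w : V) : V := w - dot w y *: y.

(* The tension field tr (nabla d phi) at x, computed in an orthonormal frame e
   of the tangent space: the covariant acceleration of phi along the geodesic
   with velocity e_j is the tangential part of the acceleration in R^(n + 2). *)
Definition tension (phi : V -> V) (x : V) (e : 'I_n.+1 -> V) : V :=
  \sum_j tangential (phi x)
    (derive1n 2 (fun s : R => phi (great_circle x (e j) s)) 0).

Definition tangent_frame (x : V) (e : 'I_n.+1 -> V) : Prop :=
  (forall j, dot x (e j) = 0) /\
  (forall i j, dot (e i) (e j) = (i == j)%:R).

Definition harmonic_self_map (phi : V -> V) : Prop :=
  [/\ {in sphere, forall x, phi x \in sphere}, smooth_on_sphere phi &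
      forall x e, sphere x -> tangent_frame x e -> tension phi x e = 0].

Section Group.
Variable G : set 'M[R]_n.+2.

Definition stabilizer (x : V) : set 'M[R]_n.+2 :=
  [set a | G a /\ a *m x = x].

(* The isotropy group of a point of a principal orbit is, up to conjugation,
   contained in every other isotropy group. *)
Definition principal_point (x : V) : Prop :=
  forall y, sphere y ->
    exists2 a, G a & forall b, stabilizer x b -> stabilizer y (a *m b *m a^T).

(* The Lie algebra of the closed linear group G, as velocities at the identity
   of curves in G. *)
Definition lie_algebra : set 'M[R]_n.+2 :=
  [set X | exists a : R -> 'M[R]_n.+2,
     [/\ forall t, G (a t), a 0 = 1%:M & is_derive (0 : R) 1 a X]].

Definition orbit_tangent (x : V) : set V :=
  [set u | exists2 X, lie_algebra X & u = X *m x].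

(* Let the orbit of x be a principal hypersurface with unit normal nu at x. The
   equivariant unit normal field a x |-> a nu has derivative X nu in the
   direction X x, so the shape operator - (nabla nu) maps X x to - X nu. *)
Definition principal_space (x nu : V) (k : R) : set V :=
  [set u | exists X, [/\ lie_algebra X, u = X *m x & - (X *m nu) = k *: u]].

End Group.
End Sphere.

(* A compact Lie group acting isometrically on the round sphere acts through
   its image in the orthogonal group, a compact subgroup G; conversely every
   compact subgroup of the orthogonal group is a Lie group. The normal geodesic
   is gamma t = great_circle p v t. *)
Record cohomogeneity_one_action (R : realType) (g m0 m1 : nat)
    (G : set 'M[R]_((orbit_dim g m0 m1).+2))
    (p v : 'cV[R]_((orbit_dim g m0 m1).+2)) : Prop := {
  action_one : G 1%:M;
  action_mul : forall a b, G a -> G b -> G (a *m b);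
  action_inv : forall a, G a -> G a^T;
  action_orthogonal : forall a, G a -> a^T *m a = 1%:M;
  action_compact : compact G;
  geodesic_unit : [/\ dot p p = 1, dot v v = 1 & dot p v = 0];
  geodesic_normal : forall t u, orbit_tangent G (great_circle p v t) u ->
    dot u (great_circle v (- p) t) = 0;
  geodesic_start : ~ principal_point G p;
  (* The orbit space is isometric to [0, pi / g]: t |-> G (gamma t) is onto, and
     the distance between the orbits of gamma s and gamma t is |s - t|. *)
  orbit_space_onto : forall x, sphere x ->
    exists a t, [/\ G a, 0 <= t <= pi / g%:R & x = a *m great_circle p v t];
  orbit_space_isometric : forall s t a,
    0 <= s <= pi / g%:R -> 0 <= t <= pi / g%:R -> G a ->
    `|s - t| <= acos (dot (great_circle p v s) (a *m great_circle p v t));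
  orbit_principal : forall t, 0 < t < pi / g%:R ->
    principal_point G (great_circle p v t);
  orbit_hypersurface : forall t, 0 < t < pi / g%:R ->
    has_dim (orbit_tangent G (great_circle p v t)) (orbit_dim g m0 m1);
  (* The g distinct principal curvatures with respect to - gamma' t, listed in
     decreasing order; the largest one, with multiplicity m0, becomes infinite
     at gamma 0. *)
  orbit_curvatures : forall t, 0 < t < pi / g%:R ->
    exists kappa : 'I_g -> R,
      [/\ forall i j : 'I_g, (i < j)%N -> kappa j < kappa i,
          forall i : 'I_g,
            has_dim (principal_space G (great_circle p v t)
                       (- great_circle v (- p) t) (kappa i)) (mult m0 m1 i)
        & forall k u,
            principal_space G (great_circle p v t)
              (- great_circle v (- p) t) k u -> u != 0 ->
            exists i, k = kappa i]
}.

Section Energy.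
Variables (R : realType) (g m0 m1 : nat) (c : R).

Local Notation shift i := (i%:R * (pi / g%:R) : R).

(* At the two ends of the interval, where a denominator vanishes, the integrand
   takes a conventional value; these points have measure zero. *)
Definition energy (r : R -> R) : R :=
  c * \int[lebesgue_measure]_(t in `[0, pi / g%:R])
    ((derive1 r t ^+ 2 +
      \sum_(i < g) (mult m0 m1 i)%:R *
         (sin (r t - shift i) ^+ 2 / sin (t - shift i) ^+ 2)) *
     \prod_(i < g) `|sin (t - shift i)| ^+ mult m0 m1 i).

(* Smooth functions on the closed interval are the restrictions of smooth
   functions on the real line. *)
Definition equivariant_variation (xi : R -> R) : Prop :=
  [/\ forall k t, derivable (derive1n k xi) t 1, xi 0 = 0 & xi (pi / g%:R) = 0].

Definition energy_along (r xi : R -> R) (s : R) : R :=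
  energy (fun t => r t + s * xi t).

Definition second_variation (r xi : R -> R) : R := derive1n 2 (energy_along r xi) 0.

Definition has_second_variation (r xi : R -> R) : Prop :=
  (\forall s \near (0 : R), derivable (energy_along r xi) s 1) /\
  derivable (derive1 (energy_along r xi)) 0 1.

(* The existence clause is there because derivatives are total functions with
   a conventional value where they do not exist. *)
Definition positive_second_variation (r : R -> R) : Prop :=
  forall xi, equivariant_variation xi ->
    (exists t, 0 <= t <= pi / g%:R /\ xi t != 0) ->
    has_second_variation r xi /\ 0 < second_variation r xi.

End Energy.

Definition equivariant_map (R : realType) (n g : nat)
    (G : set 'M[R]_n.+2) (p v : 'cV[R]_n.+2)
    (phi : 'cV[R]_n.+2 -> 'cV[R]_n.+2) (r : R -> R) : Prop :=
  [/\ r 0 = 0, exists k : int, r (pi / g%:R) = k%:~R * (pi / g%:R) &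
      forall a t, G a -> 0 <= t <= pi / g%:R ->
        phi (a *m great_circle p v t) = a *m great_circle p v (r t)].

Definition equivariantly_stable_harmonic (R : realType) (g m0 m1 : nat) (c : R)
    (G : set 'M[R]_((orbit_dim g m0 m1).+2))
    (p v : 'cV[R]_((orbit_dim g m0 m1).+2))
    (phi : 'cV[R]_((orbit_dim g m0 m1).+2) -> 'cV[R]_((orbit_dim g m0 m1).+2))
    (r : R -> R) : Prop :=
  [/\ equivariant_map g G p v phi r, harmonic_self_map phi &
      positive_second_variation g m0 m1 c r].

(* Main.v *)
(* With nodes a_i = i pi / g and P = prod_i |sin (t - a_i)|^(m_i), the second
   variation at r = id is 2 c times the integral of
     (xi'^2 + sum_i m_i (1 / sin^2 (t - a_i) - 2) xi^2) P.
   The function u = prod_i sin (t - a_i) is a first eigenfunction of the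
   corresponding Jacobi operator, with eigenvalue
   lambda = g^2 + (g - 2) sum_i m_i > 0.  Completing the square along u'/u,
   the integrand becomes
     (xi' - (u'/u) xi)^2 P + ((u'/u) xi^2 P)' + lambda xi^2 P,
   and the boundary term vanishes since P does and xi / sin (t - a_i) is
   bounded.  That u is an eigenfunction is an identity for sums of cotangents:
   cot x cot y = cot (x - y) (cot y - cot x) - 1 makes the products linear, and
   the linear terms cancel by a reflection of Z/g that preserves the m_i. *)
Require Import Defs.
From mathcomp Require Import all_boot all_order all_algebra.
From mathcomp Require Import all_classical all_reals all_analysis.
From mathcomp Require Import ring lra zify.

Set Implicit Arguments.
Unset Strict Implicit.
Unset Printing Implicit Defensive.

Import Order.TTheory GRing.Theory Num.Theory.
Import numFieldNormedType.Exports.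

Local Open Scope classical_set_scope.
Local Open Scope ring_scope.

(** * Cotangent: period, subtraction formula and derivative *)

Section Cotangent.
Context {R : realType}.
Implicit Types x y : R.

(* At the zeros of [sin] this takes the value 0. *)
Definition cot x : R := cos x / sin x.

Lemma cotN x : cot (- x) = - cot x.
Proof. by rewrite /cot cosN sinN invrN mulrN. Qed.

Lemma cotDnpi x n : cot (x + n%:R * pi) = cot x.
Proof.
elim: n => [|n IHn]; first by rewrite mul0r addr0.
by rewrite -natr1 mulrDl mul1r addrA /cot sinDpi cosDpi invrN mulrNN.
Qed.

Lemma cot_sqr x : sin x != 0 -> cot x ^+ 2 = sin x ^- 2 - 1.
Proof. by move=> sx; rewrite /cot exprMn cos2sin2 exprVn mulrBl mul1r mulfV ?expf_neq0. Qed.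

Lemma cotM x y : sin x != 0 -> sin y != 0 -> sin (x - y) != 0 ->
  cot x * cot y = cot (x - y) * (cot y - cot x) - 1.
Proof.
move=> sx sy; rewrite /cot sinB cosB => sxy.
by field; rewrite sx sy sxy.
Qed.

Lemma is_derive_cot x : sin x != 0 -> is_derive x 1 cot (- sin x ^- 2).
Proof.
move=> sx.
have dV : is_derive x 1 (fun y => (sin y)^-1) (- (sin x) ^- 2 *: cos x).
  exact: is_deriveV.
apply: is_derive_eq (is_deriveM _ _) _.
rewrite /GRing.scale /= -[in RHS](mulr1 (sin x ^- 2)) -(cos2Dsin2 x).
by field.
Qed.

End Cotangent.

(** * Products of sums of cotangents over equally spaced nodes *)

Section CotangentSums.
Context {R : realType}.
Variable g : nat.
Hypothesis g0 : (0 < g)%N.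
Implicit Types t : R.

Definition angle (i : nat) t : R := t - i%:R * (pi / g%:R).

Let g0R : g%:R != 0 :> R. Proof. by rewrite pnatr_eq0 -lt0n. Qed.

Lemma angleB i j t : angle i t - angle j t = (j%:R - i%:R) * (pi / g%:R).
Proof. by rewrite /angle; ring. Qed.

Lemma sin_angle_gt0 n : (0 < n < g)%N -> 0 < sin (n%:R * (pi / g%:R) : R).
Proof.
move=> /andP[n0 ng]; apply: sin_gt0_pi; rewrite mulrCA.
rewrite mulr_gt0 ?pi_gt0 ?divr_gt0 ?ltr0n//=.
by rewrite gtr_pMr ?pi_gt0// ltr_pdivrMr ?ltr0n// mul1r ltr_nat.
Qed.

Lemma sin_angleB_neq0 i j t : (i < g)%N -> (j < g)%N -> i != j ->
  sin (angle i t - angle j t) != 0.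
Proof.
rewrite angleB => ig jg; rewrite neq_ltn => /orP[ij|ji].
  by rewrite -natrB 1?ltnW// gt_eqF// sin_angle_gt0//; lia.
rewrite -opprB mulNr sinN oppr_eq0 -natrB 1?ltnW// gt_eqF// sin_angle_gt0//.
by lia.
Qed.

(* The reflection i |-> 2 j - i of Z/g changes the sign of every cotangent. *)
Lemma sum_cot_eq0 (j : 'I_g) (w : nat -> R) :
  (forall i, (i < g)%N -> w ((j + j + g - i) %% g)%N = w i) ->
  \sum_(i < g) w i * cot ((j%:R - i%:R) * (pi / g%:R)) = 0 :> R.
Proof.
move=> wE; set S := LHS.
pose rho (i : 'I_g) : 'I_g := Ordinal (ltn_pmod (j + j + g - i) g0).
have rhoK : involutive rho.
  move=> i; apply: val_inj => /=; have := ltn_ord i; have := ltn_ord j => jg ig.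
  set q := (j + j + g - i)%N; set r := (q %% g)%N.
  have qE : q = (q %/ g * g + r)%N by exact: divn_eq.
  have -> : (j + j + g - r = q %/ g * g + i)%N.
    have := ltn_pmod q g0; rewrite -/r => rg.
    by rewrite /q in qE *; lia.
  by rewrite modnMDl modn_small.
suff : S = - S by lra.
rewrite {1}/S (reindex_inj (inv_inj rhoK)) -sumrN; apply: eq_bigr => i _ /=.
rewrite wE// -mulrN -cotN; congr (_ * _).
set q := (j + j + g - i)%N.
have qE : q%:R = (q %/ g)%:R * g%:R + (q %% g)%:R :> R.
  by rewrite -natrM -natrD -divn_eq.
have q2 : q%:R = j%:R + j%:R + g%:R - i%:R :> R.
  by rewrite natrB ?natrD//; have := ltn_ord i; lia.
(* A change of the index by [g] shifts the argument by [pi], a period. The [g] that keeps the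
   subtraction in [q] from truncating costs one period, and the reduction modulo [g] costs [q %/ g]
   of them. *)
rewrite -(cotDnpi _ 1) -[RHS](cotDnpi _ (q %/ g)); congr cot.
have -> : (q %% g)%:R = j%:R + j%:R + g%:R - i%:R - (q %/ g)%:R * g%:R :> R.
  by rewrite -q2 qE; ring.
by field.
Qed.

(** In the expanded double sum [cotM] linearises every off-diagonal product. The linear terms have
    coefficients that are sums of [c i j] over one index, weighted by [w] or by 1. Both weights are
    invariant under all the reflections, so these sums vanish by [sum_cot_eq0]. What remains is the
    diagonal and the constant -1 of each pair. *)
Lemma sum_cot_mul_sum_cot t (w : nat -> R) :
  (forall i j, (i < g)%N -> (j < g)%N -> w ((j + j + g - i) %% g)%N = w i) ->
  (forall i, (i < g)%N -> sin (angle i t) != 0) ->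
  (\sum_(i < g) w i * cot (angle i t)) * (\sum_(i < g) cot (angle i t)) =
  \sum_(i < g) w i * sin (angle i t) ^- 2 - g%:R * \sum_(i < g) w i.
Proof.
move=> wE s0; set X := fun i => cot (angle i t).
pose c (i j : nat) : R := cot ((j%:R - i%:R) * (pi / g%:R)).
(* One formula serves for all pairs: on the diagonal the two terms in [c i i] cancel, and the last
   term completes -1 to the squared cotangent. *)
have XX (i j : 'I_g) : X i * X j =
    c i j * X j - c i j * X i - 1 + (i == j)%:R * sin (angle i t) ^- 2.
  have [<-|ij] := eqVneq i j.
    by rewrite -expr2 cot_sqr ?s0 //= mul1r; ring.
  by rewrite cotM ?s0 ?sin_angleB_neq0 //= angleB mul0r addr0 -/(c i j) /X; ring.
have sum_wc j : (j < g)%N -> \sum_(i < g) w i * c i j = 0.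
  by move=> jg; apply: (@sum_cot_eq0 (Ordinal jg)) => i ig; exact: wE.
have sum_c (i : 'I_g) : \sum_(j < g) c i j = 0.
  transitivity (- \sum_(j < g) 1 * c j i); last first.
    by rewrite (@sum_cot_eq0 i (fun=> 1)) ?oppr0.
  rewrite -sumrN; apply: eq_bigr => j _.
  by rewrite mul1r /c -cotN -mulNr opprB.
have sum_delta (i : 'I_g) s : \sum_(j < g) (i == j)%:R * s = s :> R.
  rewrite (bigD1 i)//= eqxx mul1r big1 ?addr0// => j ji.
  by rewrite eq_sym (negbTE ji) mul0r.
transitivity (\sum_(i < g) \sum_(j < g) (w i * c i j * X j
    - w i * X i * c i j - w i + w i * ((i == j)%:R * sin (angle i t) ^- 2))).
  rewrite mulr_suml; apply: eq_bigr => i _; rewrite mulr_sumr.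
  by apply: eq_bigr => j _; rewrite -mulrA XX; ring.
under eq_bigr => i _.
  rewrite big_split/= sumrB sumrB -!mulr_sumr sum_c mulr0 subr0.
  rewrite sumr_const card_ord sum_delta.
  over.
rewrite big_split sumrB /= exchange_big/= big1 ?add0r; last first.
  by move=> j _; rewrite -mulr_suml sum_wc ?mul0r.
by rewrite addrC sumrMnl mulr_natl.
Qed.

End CotangentSums.

(** * Lower bounds for the sines, bounds on variations, and the weight *)

Section Weight.
Context {R : realType}.

(** With [y = x / 2], the mean value theorem gives [sin y >= y * cos y]. Hence
    [sin x = 2 sin y cos y] is at least [2 y cos^2 y], and [2 cos^2 y >= 1] because [cos x >= 0]. *)
Lemma sin_ge_half (x : R) : 0 <= x <= pi / 2 -> x / 2 <= sin x.
Proof.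
move=> /andP[x0 xpi]; set y := x / 2.
have [y0 ypi] : 0 <= y /\ y <= pi / 2 by split; rewrite /y; lra.
have -> : x = y *+ 2 by rewrite /y -mulr_natr; field.
have [c /[!in_itv]/= /andP[c0 cy] Dsin] :
    exists2 c, c \in `[0, y]%R & sin y - sin 0 = cos c * (y - 0).
  apply: MVT_segment => //.
  by apply: continuous_subspaceT => z; exact: continuous_sin.
have cosy : cos y <= cos c.
  have [->//|cney] := eqVneq c y.
  by rewrite ltW// ltr_cos ?in_itv//=; [rewrite lt_neqAle cney|have := @pi_ge0 R; lra..].
have cosx : 0 <= cos (y *+ 2).
  by apply: cos_ge0_pihalf; have := @pi_ge0 R; rewrite /y -mulr_natr; lra.
have cy0 : 0 <= cos y by apply: cos_ge0_pihalf; have := @pi_ge0 R; lra.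
move: cosx Dsin; rewrite cos_mulr2n sin_mulr2n sin0 !subr0 => cosx ->.
have cc : cos y * cos y <= cos y * cos c by rewrite ler_wpM2l.
have -> : (cos y * (cos c * y)) *+ 2 = (cos y * cos c) *+ 2 * y by ring.
by rewrite ler_peMl//; move: cosx cc; rewrite expr2 !mulr2n; lra.
Qed.

Variables g m0 m1 : nat.
Hypothesis g1 : (1 < g)%N.

Let g0 : (0 < g)%N. Proof. exact: ltnW. Qed.

Lemma step_gt0 : 0 < pi / g%:R :> R.
Proof. by rewrite divr_gt0 ?pi_gt0// ltr0n. Qed.

Lemma step_le_pihalf : pi / g%:R <= pi / 2 :> R.
Proof. by rewrite ler_pM2l ?pi_gt0// lef_pV2 ?posrE ?ltr0n// ler_nat. Qed.

Lemma sin_angle_ge0 (t : R) : 0 <= t <= pi / g%:R ->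
  t / 2 <= `|sin (angle g 0 t)|.
Proof.
move=> /andP[t0 ta]; rewrite /angle mul0r subr0.
apply: le_trans (ler_norm _); apply: sin_ge_half; rewrite t0.
exact: le_trans ta step_le_pihalf.
Qed.

(** Write [a] for [pi / g]. The number [i a - t] is at distance at least [a - t] from 0 since
    [i >= 1], and from [pi] since [(i + 1) a <= pi]. Then [sin_ge_half] applies at the nearer of the
    two zeros of the sine. *)
Lemma sin_angle_geS i (t : R) : (0 < i < g)%N -> 0 <= t <= pi / g%:R ->
  (pi / g%:R - t) / 2 <= `|sin (angle g i t)|.
Proof.
move=> /andP[i0 ig] /andP[t0 ta]; rewrite /angle -(opprB _ t) sinN normrN.
apply: le_trans (ler_norm _).
have i1 : 1 <= i%:R :> R by rewrite ler1n.
have gi : i%:R + 1 <= g%:R :> R by rewrite natr1 ler_nat.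
have a0 := step_gt0; have api : g%:R * (pi / g%:R) = pi :> R.
  by rewrite mulrC divfK// pnatr_eq0 -lt0n.
have ia : pi / g%:R <= i%:R * (pi / g%:R) :> R by rewrite ler_peMl// ltW.
have aia : i%:R * (pi / g%:R) + pi / g%:R <= pi :> R.
  by rewrite -[leRHS]api -[X in _ + X]mul1r -mulrDl ler_wpM2r// ltW.
have [xle|xgt] := leP (i%:R * (pi / g%:R) - t) (pi / 2).
  apply: (@le_trans _ _ ((i%:R * (pi / g%:R) - t) / 2)); first by lra.
  by apply: sin_ge_half; lra.
rewrite -[leRHS]opprK -sinN -sinDpi.
apply: (@le_trans _ _ ((- (i%:R * (pi / g%:R) - t) + pi) / 2)); first by lra.
by apply: sin_ge_half; lra.
Qed.

Lemma sin_angle_neq0 i (t : R) : (i < g)%N -> 0 < t < pi / g%:R ->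
  sin (angle g i t) != 0.
Proof.
move=> ig /andP[t0 ta]; rewrite -normr_gt0.
have tI : 0 <= t <= pi / g%:R by rewrite !ltW.
case: i ig => [|i] ig.
  by rewrite (lt_le_trans _ (sin_angle_ge0 tI))// divr_gt0.
by rewrite (lt_le_trans _ (@sin_angle_geS i.+1 _ _ tI))// divr_gt0 ?subr_gt0.
Qed.

(** By the mean value theorem [f], which vanishes at both ends, is at most the maximum of [|df|]
    times the distance to either end. The distance to 0 is controlled by the sine at node 0, the
    distance to [pi / g] by the sine at every other node. This bound makes all the quotients by
    sines below bounded. *)
Lemma variation_bound (f df : R -> R) :
  (forall t : R, is_derive t 1 f (df t)) -> continuous df ->
  f 0 = 0 -> f (pi / g%:R) = 0 ->
  exists2 K, 0 <= K & forall t, 0 <= t <= pi / g%:R ->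
    `|df t| <= K /\ forall i, (i < g)%N -> `|f t| <= K * `|sin (angle g i t)|.
Proof.
move=> fdf cdf f0 fa; have a0 := step_gt0.
have [c _ dfc] : exists2 c, c \in `[0, pi / g%:R]%R &
    forall t, t \in `[0, pi / g%:R]%R -> `|df t| <= `|df c|.
  apply: (EVT_max (ltW a0)); apply: continuous_subspaceT => t.
  exact: (continuous_comp (cdf t) (@norm_continuous _ _ _)).
have mvt s t : 0 <= s -> s <= t -> t <= pi / g%:R ->
    `|f t - f s| <= `|df c| * (t - s).
  move=> s0 st ta.
  have [d /[!in_itv]/= /andP[sd dt] ->] :
      exists2 d, d \in `[s, t]%R & f t - f s = df d * (t - s).
    apply: MVT_segment => //; apply: continuous_subspaceT => z.
    exact/differentiable_continuous/derivable1_diffP.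
  rewrite normrM [X in _ * X]ger0_norm ?subr_ge0// ler_wpM2r ?subr_ge0//.
  by apply: dfc; rewrite in_itv/= (le_trans s0 sd) (le_trans dt ta).
(* The factor 2 compensates for the 1/2 in the lower bounds of the sines. *)
exists (2 * `|df c|) => [|t tI]; first by rewrite mulr_ge0.
have /andP[t0 ta] := tI; split.
  by apply: le_trans (dfc t _) _; rewrite ?in_itv/= ?t0//; have := normr_ge0 (df c); lra.
case=> [_|i ig].
  have := mvt 0 t; rewrite f0 !subr0 => /(_ _ _ _)/le_trans; apply=> //.
  by rewrite [leRHS]mulrAC [leRHS]mulrC ler_wpM2l//; have := sin_angle_ge0 tI; lra.
have := mvt t (pi / g%:R); rewrite fa sub0r normrN => /(_ _ _ _)/le_trans; apply=> //.
rewrite [leRHS]mulrAC [leRHS]mulrC ler_wpM2l//.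
by have := @sin_angle_geS i.+1 _ ig tI; lra.
Qed.

Definition weight (t : R) : R := \prod_(i < g) `|sin (angle g i t)| ^+ mult m0 m1 i.

Lemma weight_ge0 t : 0 <= weight t.
Proof. by apply: prodr_ge0 => i _; rewrite exprn_ge0. Qed.

Lemma weight_gt0 t : 0 < t < pi / g%:R -> 0 < weight t.
Proof.
by move=> tI; apply: prodr_gt0 => i _; rewrite exprn_gt0// normr_gt0 sin_angle_neq0.
Qed.

Lemma weight_le1 t : weight t <= 1.
Proof.
apply: prodr_ile1 => i _.
by rewrite exprn_ge0//= exprn_ile1 ?sin_max.
Qed.

Lemma weight0 : (0 < m0)%N -> weight 0 = 0.
Proof.
move=> m0_gt0; rewrite /weight (bigD1 (Ordinal g0))//= /angle mul0r subr0 sin0.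
by rewrite normr0 expr0n/= /mult/= eqn0Ngt m0_gt0 mul0r.
Qed.

Lemma weight_step : (0 < m1)%N -> weight (pi / g%:R) = 0.
Proof.
move=> m1_gt0; rewrite /weight (bigD1 (Ordinal g1))//= /angle mul1r subrr sin0.
by rewrite normr0 expr0n/= /mult/= eqn0Ngt m1_gt0 mul0r.
Qed.

Lemma continuous_angle i : continuous (angle g i : R -> R).
Proof. by move=> t; apply: cvgB; [exact: cvg_id|exact: cvg_cst]. Qed.

Lemma continuous_sin_angle i : continuous (fun t : R => sin (angle g i t)).
Proof.
by move=> t; apply: continuous_comp; [exact: continuous_angle|exact: continuous_sin].
Qed.

Lemma continuous_weight : continuous weight.
Proof.
apply: continuous_big => [|i _ t]; first exact: mul_continuous.
have cnorm : `|sin (angle g i u)| @[u --> t] --> `|sin (angle g i t)|.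
  by apply: cvg_norm; exact: continuous_sin_angle.
exact: (continuous_comp cnorm (@exprn_continuous _ (mult m0 m1 i) _)).
Qed.

End Weight.

(** * Continuity up to the end points, logarithmic derivatives, integrals *)

Section RealAnalysis.
Context {R : realType}.
Implicit Types (f P : R -> R) (a b s t x : R).

(** Meant for an [f] with denominators that vanish at the ends. As [f] is bounded inside, [P] forces
    the product to tend to 0 there, and 0 is also its value, whatever value [f] takes at the end
    points. *)
Lemma within_continuous_mul_vanish f P a b C : a < b ->
  {in `]a, b[%R, continuous f} -> {in `]a, b[%R, forall t, `|f t| <= C} ->
  continuous P -> P a = 0 -> P b = 0 ->
  {within `[a, b], continuous (fun t => f t * P t)}.
Proof.
move=> ab cf fC cP Pa Pb; apply/continuous_within_itvP => //.
have vanish x (F : set_system R) : Filter F -> F --> x -> P x = 0 ->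
    F `]a, b[%classic -> f t * P t @[t --> F] --> f x * P x.
  move=> FF Fx Px Fab; rewrite Px mulr0; apply: norm_cvg0.
  apply: (@squeeze_cvgr _ _ _ _ (cst 0) (fun t => C * `|P t|)).
  - apply: filterS Fab => t tab.
    by rewrite /= normr_ge0 normrM ler_wpM2r//= fC.
  - exact: cvg_cst.
  - rewrite -(mulr0 C); apply: cvgM; first exact: cvg_cst.
    rewrite -(@normr0 _ R) -Px; apply: cvg_norm.
    exact: (cvg_trans (cvg_app _ Fx) (cP x)).
split.
- by move=> t tab; apply: cvgM; [exact: cf|exact: cP].
- apply: vanish => //; first exact: cvg_within.
  near=> t; rewrite /= in_itv/=; apply/andP; split; near: t.
    exact: nbhs_right_gt.
  exact: nbhs_right_lt.
- apply: vanish => //; first exact: cvg_within.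
  near=> t; rewrite /= in_itv/=; apply/andP; split; near: t.
    exact: nbhs_left_gt.
  exact: nbhs_left_lt.
Unshelve. all: by end_near. Qed.

Lemma is_derive_normr x : x != 0 -> is_derive x 1 (fun y : R => `|y|) (`|x| / x).
Proof.
have dN : is_derive x 1 (-%R : R -> R) (-1) := is_deriveNid x 1.
rewrite neq_lt => /orP[x0|x0].
  rewrite ltr0_norm// mulNr divff ?lt_eqF//.
  apply: (@near_eq_is_derive _ _ _ -%R).
  near=> y; rewrite ltr0_norm//; near: y.
  exact: lt_nbhsl.
rewrite gtr0_norm// divff ?gt_eqF//.
apply: (@near_eq_is_derive _ _ _ id).
near=> y; rewrite gtr0_norm//; near: y.
exact: lt_nbhsr.
Unshelve. all: by end_near. Qed.

(** The logarithmic derivatives [l i] enter multiplicatively, so that no factor has to be divided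
    by. *)
Lemma is_derive_prod_log n (f : 'I_n -> R -> R) (l : 'I_n -> R) x :
  (forall i, is_derive x 1 (f i) (f i x * l i)) ->
  is_derive x 1 (fun y => \prod_(i < n) f i y) (\prod_(i < n) f i x * \sum_(i < n) l i).
Proof.
elim: n f l => [|n IHn] f l df.
  under eq_fun do rewrite big_ord0.
  by rewrite !big_ord0 mulr0; exact: is_derive_cst.
under eq_fun do rewrite big_ord_recl.
rewrite !big_ord_recl.
apply: is_derive_eq (is_deriveM (df ord0) (IHn _ _ (fun i => df (lift ord0 i)))) _.
by rewrite /GRing.scale /=; ring.
Qed.

Lemma is_derive_sumr n (f : 'I_n -> R -> R) (df : 'I_n -> R) x :
  (forall i, is_derive x 1 (f i) (df i)) ->
  is_derive x 1 (fun y => \sum_(i < n) f i y) (\sum_(i < n) df i).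
Proof.
move=> fdf; rewrite (_ : (fun y => _) = \sum_(i < n) f i).
  exact: is_derive_sum.
by apply/funext => y; rewrite fct_sumE.
Qed.

Local Notation mu := (@lebesgue_measure R).

Lemma is_derive_Rintegral (f df : R -> R -> R) a b s :
  (forall s, {within `[a, b], continuous (f s)}) ->
  (forall s t, t \in `[a, b]%R -> is_derive s 1 (f^~ t) (df s t)) ->
  (exists C, forall x t, `|x - s| < 1 -> t \in `[a, b]%R -> `|df x t| <= C) ->
  is_derive s 1 (fun x => \int[mu]_(t in `[a, b]) f x t)
    (\int[mu]_(t in `[a, b]) df s t).
Proof.
move=> cf fdf [C dfC].
have sI : `]s - 1, s + 1[%classic s by rewrite /= in_itv/= ltrBlDr !ltrDl ltr01.
have intf x : `]s - 1, s + 1[%classic x -> mu.-integrable `[a, b] (EFin \o f x).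
  by move=> _; apply: continuous_compact_integrable => //; exact: segment_compact.
have derf x t : `]s - 1, s + 1[%classic x -> `[a, b]%classic t ->
    derivable (f^~ t) x 1.
  by move=> _ tab; have := fdf x t tab.
(* The dominating function has to be nonnegative, whence the absolute value. *)
have intC : mu.-integrable `[a, b] (EFin \o cst `|C|).
  apply: continuous_compact_integrable; first exact: segment_compact.
  by apply: continuous_subspaceT => x; exact: cvg_cst.
have ubC x t : `]s - 1, s + 1[%classic x -> `[a, b]%classic t ->
    `|partial1of2 f x t| <= `|C|.
  rewrite /= in_itv/= => /andP[sx xs] tab; rewrite partial1of2E.
  rewrite (derive_val (is_derive := fdf x t tab)).
  apply: le_trans (ler_norm C); apply: dfC => //.
  by rewrite ltr_norml; lra.
have C0 (t : R) : 0 <= cst `|C| t by exact: normr_ge0.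
apply: DeriveDef.
  exact: (derivable_under_integral _ sI intf derf C0 intC ubC).
rewrite -derive1E (differentiation_under_integral _ sI intf derf C0 intC ubC)//.
apply: eq_Rintegral => t; rewrite inE => tab.
by rewrite partial1of2E (derive_val (is_derive := fdf s t tab)).
Qed.

Lemma Rintegral_gt0 f a b t0 : {within `[a, b], continuous f} ->
  (forall t, t \in `[a, b]%R -> 0 <= f t) ->
  t0 \in `]a, b[%R -> 0 < f t0 ->
  0 < \int[mu]_(t in `[a, b]) f t.
Proof.
move=> cf f0 t0ab ft0.
have ab : a < b by move: t0ab; rewrite in_itv/= => /andP[]; exact: lt_trans.
have intf : mu.-integrable `[a, b] (EFin \o f).
  by apply: continuous_compact_integrable => //; exact: segment_compact.
have /continuous_within_itvP[//|cin _ _] := cf.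
have : \forall t \near t0, f t0 / 2 < f t /\ t \in `]a, b[%R.
  near=> t; split; near: t.
    by apply: (cvgr_gt (f t0)); [exact: cin|rewrite ltr_pdivrMr// mulr2n; lra].
  exact: near_in_itvoo.
move=> /nbhs_ballP[e /= e0 be].
(* Half the radius, so that the closed interval around [t0] stays in the open ball. *)
pose d := e / 2; have d0 : 0 < d by rewrite divr_gt0.
have sub t : t0 - d <= t <= t0 + d -> f t0 / 2 < f t /\ t \in `]a, b[%R.
  move=> td; apply: be; rewrite /ball/= ltr_norml.
  by rewrite /d in td *; lra.
have sub' : `[t0 - d, t0 + d] `<=` `[a, b]%classic.
  move=> t /=; rewrite in_itv/= => /sub[_].
  by rewrite !in_itv/= => /andP[at_ tb]; rewrite !ltW.
have /integrableP[mf _] := intf.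
rewrite fine_gt0//; apply/andP; split; last first.
  by apply: integrable_lty.
apply: (@lt_le_trans _ _ (\int[mu]_(t in `[(t0 - d)%R, (t0 + d)%R]) (f t0 / 2)%:E)%E).
  rewrite integral_cst//= lebesgue_measure_itv/= lte_fin.
  rewrite ifT; last by lra.
  rewrite -EFinD -EFinM lte_fin mulr_gt0 ?divr_gt0//; lra.
apply: (@le_trans _ _ (\int[mu]_(t in `[(t0 - d)%R, (t0 + d)%R]) (f t)%:E)%E).
  apply: ge0_le_integral => //.
  - by move=> t _; rewrite lee_fin divr_ge0// ltW.
  - exact: (measurable_funS _ sub' mf).
  - by move=> t; rewrite /= in_itv/= => /sub[+ _]; rewrite lee_fin => /ltW.
by apply: ge0_subset_integral.
Unshelve. all: by end_near. Qed.

End RealAnalysis.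

(** * Pointwise derivatives, limits and bounds for quotients *)

Section PointwiseDerivatives.
Context {R : realType}.
Implicit Types (f u : R -> R) (x : R).

Lemma is_derive_fun_add f u x df du :
  is_derive x 1 f df -> is_derive x 1 u du ->
  is_derive x 1 (fun y => f y + u y) (df + du).
Proof. exact: is_deriveD. Qed.

Lemma is_derive_fun_mul f u x df du :
  is_derive x 1 f df -> is_derive x 1 u du ->
  is_derive x 1 (fun y => f y * u y) (df * u x + f x * du).
Proof.
move=> Df Du; apply: is_derive_eq (is_deriveM Df Du) _.
by rewrite /GRing.scale /= addrC; congr (_ + _); rewrite mulrC.
Qed.

Lemma is_derive_fun_mull k f x df :
  is_derive x 1 f df -> is_derive x 1 (fun y => k * f y) (k * df).
Proof. by move=> Df; exact: (is_deriveZ k Df). Qed.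

Lemma is_derive_fun_mulr f k x df :
  is_derive x 1 f df -> is_derive x 1 (fun y => f y * k) (df * k).
Proof.
by move=> Df; under eq_fun do rewrite mulrC; rewrite mulrC; exact: is_derive_fun_mull.
Qed.

Lemma is_derive_fun_sqr f x df :
  is_derive x 1 f df -> is_derive x 1 (fun y => f y ^+ 2) (f x * (2 * df)).
Proof.
move=> Df; rewrite (_ : (fun y => _) = (fun y => f y * f y)); last first.
  by apply/funext => y; rewrite expr2.
by apply: is_derive_eq (is_derive_fun_mul Df Df) _; ring.
Qed.

Lemma is_derive_affine a k x : is_derive x 1 (fun y : R => a + y * k) k.
Proof.
have := is_derive_fun_add (is_derive_cst a x 1)
  (is_derive_fun_mulr k (is_derive_id x 1)).
by rewrite add0r mul1r.
Qed.

Lemma is_derive_sin_affine a k x :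
  is_derive x 1 (fun y : R => sin (a + y * k)) (cos (a + x * k) * k).
Proof. exact: (is_derive1_comp (is_derive_sin _) (is_derive_affine a k x)). Qed.

Lemma is_derive_cos_affine a k x :
  is_derive x 1 (fun y : R => cos (a + y * k)) (- sin (a + x * k) * k).
Proof. exact: (is_derive1_comp (is_derive_cos _) (is_derive_affine a k x)). Qed.

Lemma is_derive_continuous f df x : is_derive x 1 f df -> {for x, continuous f}.
Proof. by move=> Df; exact/differentiable_continuous/derivable1_diffP. Qed.

Lemma cvg_exprn {T} {F : set_system T} {FF : Filter F} (h : T -> R) (l : R) n :
  h @ F --> l -> (fun t => h t ^+ n) @ F --> l ^+ n.
Proof.
move=> hl; have xn : (fun x : R => x ^+ n) @ l --> l ^+ n by exact: exprn_continuous.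
exact: (cvg_comp _ _ hl xn).
Qed.

Lemma cvg_sumr {T} {F : set_system T} {FF : Filter F} n (h : 'I_n -> T -> R) (l : 'I_n -> R) :
  (forall i, h i @ F --> l i) ->
  (fun t => \sum_(i < n) h i t) @ F --> \sum_(i < n) l i.
Proof. by move=> hl; apply: cvg_big => //; exact: add_continuous. Qed.

Lemma norm_sin_le x : `|sin x| <= `|x|.
Proof.
have pos y : 0 <= y -> `|sin y| <= y.
  move=> y0; have [c _] : exists2 c, c \in `[0, y]%R & sin y - sin 0 = cos c * (y - 0).
    apply: MVT_segment => //.
    by apply: continuous_subspaceT => z; exact: continuous_sin.
  rewrite sin0 !subr0 => ->; rewrite normrM (ger0_norm y0) ler_piMl//.
  exact: cos_max.
have [x0|/ltW x0] := leP 0 x; first by rewrite (ger0_norm x0) pos.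
by rewrite (ler0_norm x0) -normrN -sinN pos// oppr_ge0.
Qed.

Lemma norm_sinD_le x y : `|sin (x + y)| <= `|sin x| + `|y|.
Proof.
rewrite sinD (le_trans (ler_normD _ _))// lerD// normrM.
  by rewrite ler_piMr// cos_max.
by rewrite (le_trans _ (norm_sin_le y))// ler_piMl// cos_max.
Qed.

(* The bound persists at [y = 0], where the quotient is 0. *)
Lemma norm_div_le (x y C : R) : 0 <= C -> `|x| <= C * `|y| -> `|x / y| <= C.
Proof.
move=> C0; have [->|y0] := eqVneq y 0; first by rewrite invr0 mulr0 normr0.
by rewrite normrM normfV ler_pdivrMr// normr_gt0.
Qed.

Lemma norm_div_sqr_le (x y C : R) : 0 <= C -> `|x| <= C * `|y| ^+ 2 ->
  `|x / y ^+ 2| <= C.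
Proof. by move=> C0 xy; apply: norm_div_le => //; rewrite normrX. Qed.

End PointwiseDerivatives.

(** * Differentiating the energy twice under the integral sign *)

Section EnergyVariation.
Context {R : realType}.
Variables g m0 m1 : nat.
Hypotheses (g1 : (1 < g)%N) (m0_gt0 : (0 < m0)%N) (m1_gt0 : (0 < m1)%N).
Variables (xi dxi : R -> R) (K : R).
Hypothesis xi_dxi : forall t : R, is_derive t 1 xi (dxi t).
Hypothesis continuous_dxi : continuous dxi.
Hypothesis K0 : 0 <= K.
Hypothesis bound_K : forall t, 0 <= t <= pi / g%:R ->
  `|dxi t| <= K /\ forall i, (i < g)%N -> `|xi t| <= K * `|sin (angle g i t)|.
Implicit Types s t x : R.

Local Notation mu := (@lebesgue_measure R).
Local Notation alpha := (pi / g%:R : R).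
Local Notation m i := ((mult m0 m1 i)%:R : R).

(** The energy integrand of [t + s * xi t] without the weight. [density1] and [density2] are its
    first and second derivatives in [s]. *)
Definition density0 s t := (1 + s * dxi t) ^+ 2 + \sum_(i < g)
  m i * (sin (angle g i t + s * xi t) ^+ 2 / sin (angle g i t) ^+ 2).

Definition density1 s t := (1 + s * dxi t) * (2 * dxi t) + \sum_(i < g)
  m i * (sin (angle g i t + s * xi t) *
         (2 * cos (angle g i t + s * xi t) * xi t) / sin (angle g i t) ^+ 2).

Definition density2 s t := 2 * dxi t ^+ 2 + \sum_(i < g)
  m i * (2 * (cos (angle g i t + s * xi t) ^+ 2 -
              sin (angle g i t + s * xi t) ^+ 2) * xi t ^+ 2 /
         sin (angle g i t) ^+ 2).

Lemma is_derive_density0 s t : is_derive s 1 (density0^~ t) (density1 s t).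
Proof.
apply: is_derive_fun_add.
  exact: is_derive_fun_sqr (is_derive_affine 1 (dxi t) s).
apply: is_derive_sumr => i; apply: is_derive_fun_mull; apply: is_derive_fun_mulr.
apply: is_derive_eq (is_derive_fun_sqr (is_derive_sin_affine _ (xi t) s)) _.
by ring.
Qed.

Lemma is_derive_density1 s t : is_derive s 1 (density1^~ t) (density2 s t).
Proof.
apply: is_derive_fun_add.
  apply: is_derive_eq (is_derive_fun_mulr _ (is_derive_affine 1 (dxi t) s)) _.
  by ring.
apply: is_derive_sumr => i; apply: is_derive_fun_mull; apply: is_derive_fun_mulr.
apply: is_derive_eq (is_derive_fun_mul (is_derive_sin_affine _ (xi t) s)
  (is_derive_fun_mulr _ (is_derive_fun_mull 2 (is_derive_cos_affine _ (xi t) s)))) _.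
by ring.
Qed.

Let dxi_le t : t \in `[0, alpha]%R -> `|dxi t| <= K.
Proof. by rewrite in_itv => /bound_K[]. Qed.

Let xi_le t i : t \in `[0, alpha]%R -> (i < g)%N ->
  `|xi t| <= K * `|sin (angle g i t)|.
Proof. by rewrite in_itv => /bound_K[_]; apply. Qed.

Let norm_sum_le (F : 'I_g -> R) C : (forall i, `|F i| <= C) ->
  `|\sum_(i < g) m i * F i| <= \sum_(i < g) m i * C.
Proof.
move=> FC; apply: le_trans (ler_norm_sum _ _ _) _; apply: ler_sum => i _.
by rewrite normrM normr_nat ler_wpM2l.
Qed.

Let sin_shift_le S s t i : `|s| <= S -> t \in `[0, alpha]%R -> (i < g)%N ->
  `|sin (angle g i t + s * xi t)| <= (1 + S * K) * `|sin (angle g i t)|.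
Proof.
move=> sS tI ig; apply: le_trans (norm_sinD_le _ _) _.
by rewrite mulrDl mul1r lerD2l normrM -mulrA ler_pM// xi_le.
Qed.

Let affine_le S s t : `|s| <= S -> t \in `[0, alpha]%R -> `|1 + s * dxi t| <= 1 + S * K.
Proof.
move=> sS tI; apply: le_trans (ler_normD _ _) _.
by rewrite normr1 lerD2l normrM ler_pM// dxi_le.
Qed.

(** Each denominator is absorbed: by [sin_shift_le] the shifted sine is at most a constant times the
    sine at the same node. In [density1] and [density2] factors [xi t] do the same through
    [xi_le]. *)
Lemma density0_bounded S : exists C, forall s t, `|s| <= S ->
  t \in `[0, alpha]%R -> `|density0 s t| <= C.
Proof.
exists ((1 + S * K) ^+ 2 + \sum_(i < g) m i * (1 + S * K) ^+ 2) => s t sS tI.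
have S0 : 0 <= S by exact: le_trans sS.
have SK0 : 0 <= 1 + S * K by rewrite addr_ge0// mulr_ge0.
apply: le_trans (ler_normD _ _) _; apply: lerD.
  by rewrite normrX lerXn2r ?nnegrE ?affine_le.
apply: norm_sum_le => i; apply: norm_div_sqr_le; first exact: exprn_ge0.
by rewrite normrX -exprMn lerXn2r ?nnegrE ?mulr_ge0// sin_shift_le.
Qed.

Lemma density1_bounded S : exists C, forall s t, `|s| <= S ->
  t \in `[0, alpha]%R -> `|density1 s t| <= C.
Proof.
exists ((1 + S * K) * (2 * K) + \sum_(i < g) m i * ((1 + S * K) * (2 * K))) => s t sS tI.
have S0 : 0 <= S by exact: le_trans sS.
have SK0 : 0 <= 1 + S * K by rewrite addr_ge0// mulr_ge0.
apply: le_trans (ler_normD _ _) _; apply: lerD.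
  by rewrite normrM ler_pM ?affine_le// normrM ger0_norm// ler_wpM2l ?dxi_le.
apply: norm_sum_le => i; apply: norm_div_sqr_le; first by rewrite !mulr_ge0.
rewrite expr2 mulrACA normrM ler_pM ?sin_shift_le//.
rewrite !normrM ger0_norm// -!mulrA ler_wpM2l//.
by rewrite (le_trans _ (xi_le tI (ltn_ord i)))// ler_piMl ?cos_max.
Qed.

Lemma density2_bounded : exists C, forall s t,
  t \in `[0, alpha]%R -> `|density2 s t| <= C.
Proof.
exists (2 * K ^+ 2 + \sum_(i < g) m i * (2 * K ^+ 2)) => s t tI.
apply: le_trans (ler_normD _ _) _; apply: lerD.
  rewrite normrM ger0_norm// ler_wpM2l// normrX lerXn2r ?nnegrE//.
  exact: dxi_le.
apply: norm_sum_le => i; apply: norm_div_sqr_le; first by rewrite mulr_ge0// exprn_ge0.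
rewrite normrM [X in X * _]normrM [X in X * _ * _]ger0_norm// -[leLHS]mulrA -[leRHS]mulrA.
rewrite ler_wpM2l// normrX -exprMn.
(* The factor [cos^2 - sin^2] lies between -1 and 1, which makes the bound uniform in [s]. *)
apply: (@le_trans _ _ (`|xi t| ^+ 2)); last first.
  by rewrite lerXn2r ?nnegrE ?mulr_ge0//; exact: xi_le.
rewrite ler_piMl ?exprn_ge0// ler_norml.
have := cos2Dsin2 (angle g i t + s * xi t).
have := sqr_ge0 (cos (angle g i t + s * xi t)).
have := sqr_ge0 (sin (angle g i t + s * xi t)).
by lra.
Qed.

Let sin_neq0 t (i : 'I_g) : t \in `]0, alpha[%R -> sin (angle g i t) != 0.
Proof. by rewrite in_itv; exact: sin_angle_neq0. Qed.

Let continuous_xi : continuous xi.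
Proof. by move=> t; exact: is_derive_continuous. Qed.

Let cvg_shift s t i :
  (fun t => angle g i t + s * xi t) @ t --> angle g i t + s * xi t.
Proof.
apply: cvgD; first exact: continuous_angle.
by apply: cvgM; [exact: cvg_cst|exact: continuous_xi].
Qed.

Let cvg_sin_shift s t i :
  (fun t => sin (angle g i t + s * xi t)) @ t --> sin (angle g i t + s * xi t).
Proof. exact: (cvg_comp _ _ (@cvg_shift s t i) (@continuous_sin _ _)). Qed.

Let cvg_cos_shift s t i :
  (fun t => cos (angle g i t + s * xi t)) @ t --> cos (angle g i t + s * xi t).
Proof. exact: (cvg_comp _ _ (@cvg_shift s t i) (@continuous_cos _ _)). Qed.

Let cvg_affine s t : (fun t => 1 + s * dxi t) @ t --> 1 + s * dxi t.
Proof.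
apply: cvgD; first exact: cvg_cst.
by apply: cvgM; [exact: cvg_cst|exact: continuous_dxi].
Qed.

Let cvg_div_sin t (i : 'I_g) : t \in `]0, alpha[%R ->
  (fun t => (sin (angle g i t) ^+ 2)^-1) @ t --> (sin (angle g i t) ^+ 2)^-1.
Proof.
move=> tI; apply: cvgV; first by rewrite expf_neq0 ?sin_neq0.
by apply: cvg_exprn; exact: continuous_sin_angle.
Qed.

Lemma continuous_density0 s : {in `]0, alpha[%R, continuous (density0 s)}.
Proof.
move=> t tI; apply: cvgD; first by apply: cvg_exprn; exact: cvg_affine.
apply: cvg_sumr => i; apply: cvgM; first exact: cvg_cst.
by apply: cvgM; [apply: cvg_exprn; exact: cvg_sin_shift|exact: cvg_div_sin].
Qed.

Lemma continuous_density1 s : {in `]0, alpha[%R, continuous (density1 s)}.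
Proof.
move=> t tI; apply: cvgD.
  apply: cvgM; first exact: cvg_affine.
  by apply: cvgM; [exact: cvg_cst|exact: continuous_dxi].
apply: cvg_sumr => i; apply: cvgM; first exact: cvg_cst.
apply: cvgM; last exact: cvg_div_sin.
apply: cvgM; first exact: cvg_sin_shift.
apply: cvgM; last exact: continuous_xi.
by apply: cvgM; [exact: cvg_cst|exact: cvg_cos_shift].
Qed.

Lemma continuous_density2 s : {in `]0, alpha[%R, continuous (density2 s)}.
Proof.
move=> t tI; apply: cvgD.
  by apply: cvgM; [exact: cvg_cst|apply: cvg_exprn; exact: continuous_dxi].
apply: cvg_sumr => i; apply: cvgM; first exact: cvg_cst.
apply: cvgM; last exact: cvg_div_sin.
apply: cvgM; last by apply: cvg_exprn; exact: continuous_xi.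
apply: cvgM; first exact: cvg_cst.
by apply: cvgB; apply: cvg_exprn; [exact: cvg_cos_shift|exact: cvg_sin_shift].
Qed.

Local Notation P := (@weight R g m0 m1).

Lemma within_continuous_mul_weight (f : R -> R) C :
  {in `]0, alpha[%R, continuous f} ->
  (forall t, t \in `[0, alpha]%R -> `|f t| <= C) ->
  {within `[0, alpha], continuous (fun t => f t * P t)}.
Proof.
move=> cf fC; apply: (within_continuous_mul_vanish (C := C)) => //.
- exact: step_gt0.
- by move=> t tI; apply: fC; exact: subset_itv_oo_cc tI.
- exact: continuous_weight.
- exact: weight0.
- exact: weight_step.
Qed.

Lemma is_derive_Rintegral_weight (f df : R -> R -> R) s :
  (forall s, {in `]0, alpha[%R, continuous (f s)}) ->
  (forall S, exists C, forall s t, `|s| <= S -> t \in `[0, alpha]%R -> `|f s t| <= C) ->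
  (forall S, exists C, forall s t, `|s| <= S -> t \in `[0, alpha]%R -> `|df s t| <= C) ->
  (forall s t, is_derive s 1 (f^~ t) (df s t)) ->
  is_derive s 1 (fun s => \int[mu]_(t in `[0, alpha]) (f s t * P t))
    (\int[mu]_(t in `[0, alpha]) (df s t * P t)).
Proof.
move=> cf fC dfC fdf; apply: (@is_derive_Rintegral _ _ (fun s t => df s t * P t)).
- move=> x; have [C fxC] := fC `|x|.
  by apply: (within_continuous_mul_weight (C := C)) => // t; exact: fxC.
- by move=> x t _; exact: is_derive_fun_mulr.
(* The range [|s| + 1] covers the unit ball around [s], and the weight is at most 1. *)
- have [C dfxC] := dfC (`|s| + 1); exists C => x t xs tI.
  rewrite normrM (ger0_norm (weight_ge0 _ _ _ _)) -[leRHS]mulr1.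
  rewrite ler_pM ?weight_ge0 ?weight_le1// dfxC//.
  by rewrite -lerBlDl (le_trans (lerB_dist _ _))// ltW.
Qed.

Lemma energy_along_density (c s : R) :
  energy_along g m0 m1 c (fun t => t) xi s =
  c * \int[mu]_(t in `[0, alpha]) (density0 s t * P t).
Proof.
rewrite /energy_along /energy; congr (_ * _); apply: eq_Rintegral => t _.
congr ((_ ^+ 2 + _) * _).
  have D := is_derive_fun_add (is_derive_id t 1) (is_derive_fun_mull s (xi_dxi t)).
  by rewrite derive1E; exact: (derive_val (is_derive := D)).
by apply: eq_bigr => i _; rewrite /angle addrAC.
Qed.

Lemma second_variation_density c :
  has_second_variation g m0 m1 c (fun t => t) xi /\
  second_variation g m0 m1 c (fun t => t) xi =
  c * \int[mu]_(t in `[0, alpha]) (density2 0 t * P t).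
Proof.
pose E0 s := c * \int[mu]_(t in `[0, alpha]) (density0 s t * P t).
pose E1 s := c * \int[mu]_(t in `[0, alpha]) (density1 s t * P t).
pose E2 s := c * \int[mu]_(t in `[0, alpha]) (density2 s t * P t).
have dE0 s : is_derive s 1 E0 (E1 s).
  apply: is_derive_fun_mull; apply: is_derive_Rintegral_weight.
  - exact: continuous_density0.
  - exact: density0_bounded.
  - exact: density1_bounded.
  - exact: is_derive_density0.
have dE1 s : is_derive s 1 E1 (E2 s).
  apply: is_derive_fun_mull; apply: is_derive_Rintegral_weight.
  - exact: continuous_density1.
  - exact: density1_bounded.
  - by move=> S; have [C dC] := density2_bounded; exists C => s' t _; exact: dC.
  - exact: is_derive_density1.
have EE : energy_along g m0 m1 c (fun t => t) xi = E0.
  by apply/funext => s; exact: energy_along_density.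
have E01 : derive1 E0 = E1 by apply/funext => s; rewrite derive1E derive_val.
rewrite /has_second_variation /second_variation /= EE E01; split; first split.
- by near=> s; have := dE0 s.
- by have := dE1 0.
- by rewrite derive1E derive_val.
Unshelve. all: by end_near. Qed.

End EnergyVariation.

(** * Completing the square along the first eigenfunction *)

Section Positivity.
Context {R : realType}.
Variables g m0 m1 : nat.
Hypotheses (g1 : (1 < g)%N) (m0_gt0 : (0 < m0)%N) (m1_gt0 : (0 < m1)%N).
Hypothesis parity : odd g -> m0 = m1.
Variables (xi dxi : R -> R) (K : R).
Hypothesis xi_dxi : forall t : R, is_derive t 1 xi (dxi t).
Hypothesis continuous_dxi : continuous dxi.
Hypothesis K0 : 0 <= K.
Hypothesis bound_K : forall t, 0 <= t <= pi / g%:R ->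
  `|dxi t| <= K /\ forall i, (i < g)%N -> `|xi t| <= K * `|sin (angle g i t)|.
Implicit Types s t x : R.

Local Notation mu := (@lebesgue_measure R).
Local Notation alpha := (pi / g%:R : R).
Local Notation m i := ((mult m0 m1 i)%:R : R).
Local Notation P := (@weight R g m0 m1).

(** For even [g] neither the reflection nor the reduction modulo [g] changes the parity of the
    index. For odd [g] the two multiplicities agree. *)
Lemma mult_reflect i j : (i < g)%N -> (j < g)%N ->
  mult m0 m1 ((j + j + g - i) %% g) = mult m0 m1 i.
Proof.
move=> ig jg; rewrite /mult; have [/parity->|g_even] := boolP (odd g).
  by rewrite !if_same.
have : odd (j + j + g - i) = odd i.
  have ijg : (i <= j + j + g)%N by lia.
  by rewrite oddB// !oddD addbb (negbTE g_even).
by rewrite {1}(divn_eq (j + j + g - i) g) oddD oddM (negbTE g_even) andbF => /= ->.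
Qed.

(** With [u] the product of the sines, [cot_sum] is [u'/u], [log_weight'] is [P'/P] and [csc_sum] is
    [- (u'/u)'] on the open interval. *)
Definition cot_sum t : R := \sum_(i < g) cot (angle g i t).
Definition log_weight' t : R := \sum_(i < g) m i * cot (angle g i t).
Definition csc_sum t : R := \sum_(i < g) sin (angle g i t) ^- 2.
Definition jacobi_eigenvalue : R := g%:R ^+ 2 + (g%:R - 2) * \sum_(i < g) m i.

Lemma jacobi_eigenvalue_gt0 : 0 < jacobi_eigenvalue.
Proof.
rewrite ltr_wpDr ?exprn_gt0 ?ltr0n 1?ltnW// mulr_ge0//.
  by rewrite subr_ge0 ler_nat.
by apply: sumr_ge0.
Qed.

(** The eigenvalue equation for [u] in Riccati form: with [H = u'/u], [L = P'/P] and the potential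
    [Q], it reads [csc_sum - (H + L) H + Q = jacobi_eigenvalue]. It comes from [sum_cot_mul_sum_cot]
    with the weights [1 + m i]. *)
Lemma cot_sum_identity t : t \in `]0, alpha[%R ->
  (cot_sum t + log_weight' t) * cot_sum t =
  csc_sum t + \sum_(i < g) m i * (sin (angle g i t) ^- 2 - 2) +
  2 * \sum_(i < g) m i - g%:R * (g%:R + \sum_(i < g) m i).
Proof.
rewrite in_itv => /= tI.
have -> : cot_sum t + log_weight' t = \sum_(i < g) (1 + m i) * cot (angle g i t).
  by rewrite -big_split/=; apply: eq_bigr => i _; rewrite mulrDl mul1r.
rewrite (@sum_cot_mul_sum_cot _ _ _ _ (fun i => 1 + m i)); last 3 first.
- exact: ltnW.
- by move=> i j ig jg; rewrite mult_reflect.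
- by move=> i ig; exact: sin_angle_neq0.
have -> : \sum_(i < g) (1 + m i) * sin (angle g i t) ^- 2 =
    csc_sum t + \sum_(i < g) m i * sin (angle g i t) ^- 2.
  by rewrite -big_split/=; apply: eq_bigr => i _; rewrite mulrDl mul1r.
have -> : \sum_(i < g) (1 + m i) = g%:R + \sum_(i < g) m i.
  by rewrite big_split/= sumr_const card_ord.
have -> : \sum_(i < g) m i * (sin (angle g i t) ^- 2 - 2) =
    \sum_(i < g) m i * sin (angle g i t) ^- 2 - 2 * \sum_(i < g) m i.
  by rewrite mulr_sumr -sumrB; apply: eq_bigr => i _; ring.
by ring.
Qed.

Lemma is_derive_angle i t : is_derive t 1 (angle g i) 1.
Proof.
have := is_derive_fun_add (is_derive_id t 1) (is_derive_cst (- (i%:R * alpha)) t 1).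
by rewrite addr0.
Qed.

Lemma is_derive_cot_sum t : t \in `]0, alpha[%R ->
  is_derive t 1 cot_sum (- csc_sum t).
Proof.
rewrite in_itv => /= tI; rewrite /csc_sum -sumrN; apply: is_derive_sumr => i.
rewrite -[- _]mulr1.
apply: (is_derive1_comp (is_derive_cot _) (is_derive_angle i t)).
exact: sin_angle_neq0.
Qed.

Lemma is_derive_weight t : t \in `]0, alpha[%R ->
  is_derive t 1 P (P t * log_weight' t).
Proof.
rewrite in_itv => /= tI; apply: is_derive_prod_log => i.
have s0 : sin (angle g i t) != 0 by exact: sin_angle_neq0.
have Ds := is_derive1_comp (is_derive_sin (angle g i t)) (is_derive_angle i t).
have Dn := is_derive1_comp (is_derive_normr s0) Ds.
have := is_deriveX (mult m0 m1 i) Dn; rewrite exprfctE.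
move/is_derive_eq; apply.
(* The power rule involves the predecessor of the exponent, so exponent 0 is treated apart. *)
rewrite /GRing.scale /=; case: (mult m0 m1 i) => [|k]; first by rewrite !mul0r mulr0.
by rewrite exprSr /cot; field.
Qed.

(** The factor 2 matches [density2]. [boundary'] is [(boundary P)' / P], hence its term in
    [log_weight']; it is grouped into factors that stay bounded near the ends. *)
Definition boundary t := 2 * (cot_sum t * xi t ^+ 2).
Definition boundary' t := 2 * ((cot_sum t * xi t) * (2 * dxi t) +
  (cot_sum t * xi t) * (log_weight' t * xi t) - csc_sum t * xi t ^+ 2).

Lemma is_derive_boundary t : t \in `]0, alpha[%R ->
  is_derive t 1 (fun t => boundary t * P t) (boundary' t * P t).
Proof.
move=> tI; have D := is_derive_fun_mul (is_derive_fun_mull 2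
  (is_derive_fun_mul (is_derive_cot_sum tI) (is_derive_fun_sqr (xi_dxi t))))
  (is_derive_weight tI).
by apply: is_derive_eq D _; rewrite /boundary'; ring.
Qed.

Let xi_le t i : t \in `[0, alpha]%R -> (i < g)%N ->
  `|xi t| <= K * `|sin (angle g i t)|.
Proof. by rewrite in_itv => /bound_K[_]; apply. Qed.

Let xi_leK t : t \in `[0, alpha]%R -> `|xi t| <= K.
Proof.
move=> tI; apply: le_trans (xi_le tI (ltnW g1)) _.
by rewrite ler_piMr// sin_max.
Qed.

Let cot_xi_le t i : t \in `[0, alpha]%R -> (i < g)%N ->
  `|cot (angle g i t) * xi t| <= K.
Proof.
move=> tI ig; rewrite /cot mulrAC; apply: norm_div_le => //.
by rewrite normrM (le_trans _ (xi_le tI ig))// ler_piMl// cos_max.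
Qed.

Let cot_sum_xi_le t : t \in `[0, alpha]%R -> `|cot_sum t * xi t| <= \sum_(i < g) K.
Proof.
move=> tI; rewrite /cot_sum mulr_suml.
by apply: le_trans (ler_norm_sum _ _ _) _; apply: ler_sum => i _; exact: cot_xi_le.
Qed.

Let log_weight'_xi_le t : t \in `[0, alpha]%R ->
  `|log_weight' t * xi t| <= \sum_(i < g) m i * K.
Proof.
move=> tI; rewrite /log_weight' mulr_suml.
apply: le_trans (ler_norm_sum _ _ _) _; apply: ler_sum => i _.
by rewrite -mulrA normrM normr_nat ler_wpM2l// cot_xi_le.
Qed.

Let csc_sum_xi_le t : t \in `[0, alpha]%R ->
  `|csc_sum t * xi t ^+ 2| <= \sum_(i < g) K ^+ 2.
Proof.
move=> tI; rewrite /csc_sum mulr_suml.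
apply: le_trans (ler_norm_sum _ _ _) _; apply: ler_sum => i _.
rewrite mulrC; apply: norm_div_sqr_le; first exact: exprn_ge0.
by rewrite normrX -exprMn lerXn2r ?nnegrE ?mulr_ge0// xi_le.
Qed.

Let continuous_xi : continuous xi.
Proof. by move=> t; exact: is_derive_continuous. Qed.

Let cvg_cot_angle t (i : 'I_g) : t \in `]0, alpha[%R ->
  (fun t => cot (angle g i t)) @ t --> cot (angle g i t).
Proof.
rewrite in_itv => /= tI.
have := is_derive1_comp (is_derive_cot (sin_angle_neq0 g1 (ltn_ord i) tI))
  (is_derive_angle i t).
exact: is_derive_continuous.
Qed.

Let cvg_cot_sum t : t \in `]0, alpha[%R -> cot_sum @ t --> cot_sum t.
Proof. by move=> tI; apply: cvg_sumr => i; exact: cvg_cot_angle. Qed.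

Let cvg_xi2 t : (fun t => xi t ^+ 2) @ t --> xi t ^+ 2.
Proof. by apply: cvg_exprn; exact: continuous_xi. Qed.

Lemma continuous_boundary_weight :
  {within `[0, alpha], continuous (fun t => boundary t * P t)}.
Proof.
apply: (@within_continuous_mul_weight _ _ _ _ g1 m0_gt0 m1_gt0 _
  (2 * ((\sum_(i < g) K) * K))).
  move=> t tI; apply: cvgM; first exact: cvg_cst.
  by apply: cvgM; [exact: cvg_cot_sum|exact: cvg_xi2].
move=> t tI; rewrite normrM ger0_norm// ler_wpM2l// expr2 mulrA normrM.
by rewrite ler_pM ?cot_sum_xi_le ?xi_leK.
Qed.

Lemma continuous_boundary'_weight :
  {within `[0, alpha], continuous (fun t => boundary' t * P t)}.
Proof.
apply: (@within_continuous_mul_weight _ _ _ _ g1 m0_gt0 m1_gt0 _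
  (2 * ((\sum_(i < g) K) * (2 * K) +
        (\sum_(i < g) K) * (\sum_(i < g) m i * K) + \sum_(i < g) K ^+ 2))).
  move=> t tI; have cH := cvg_cot_sum tI.
  have cHxi : (fun t => cot_sum t * xi t) @ t --> cot_sum t * xi t.
    by apply: cvgM => //; exact: continuous_xi.
  apply: cvgM; first exact: cvg_cst.
  apply: cvgB; first apply: cvgD; first apply: cvgM => //.
  - by apply: cvgM; [exact: cvg_cst|exact: continuous_dxi].
  - apply: cvgM => //; apply: cvgM; last exact: continuous_xi.
    apply: cvg_sumr => i; apply: cvgM; first exact: cvg_cst.
    exact: cvg_cot_angle.
  - apply: cvgM; last exact: cvg_xi2.
    apply: cvg_sumr => i; apply: cvgV.
      by rewrite expf_neq0// sin_angle_neq0//; move: tI; rewrite in_itv.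
    by apply: cvg_exprn; exact: continuous_sin_angle.
move=> t tI; rewrite normrM ger0_norm// ler_wpM2l//.
apply: le_trans (ler_normB _ _) _; apply: lerD; last exact: csc_sum_xi_le.
have Hxi := cot_sum_xi_le tI.
apply: le_trans (ler_normD _ _) _; apply: lerD.
  rewrite normrM ler_pM// normrM ger0_norm// ler_wpM2l//.
  by move: tI; rewrite in_itv => /bound_K[].
by rewrite normrM ler_pM// log_weight'_xi_le.
Qed.

(** By the fundamental theorem of calculus this is a difference of end values of [boundary * P], and
    [P] vanishes at both ends. *)
Lemma Rintegral_boundary' : \int[mu]_(t in `[0, alpha]) (boundary' t * P t) = 0.
Proof.
have a0 : 0 < alpha by exact: step_gt0.
have [_ c0 c1] := (continuous_within_itvP _ a0).1 continuous_boundary_weight.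
rewrite /Rintegral (@continuous_FTC2 _ _ (fun t => boundary t * P t))//.
- by rewrite weight0 ?weight_step// !mulr0 sube0.
- exact: continuous_boundary'_weight.
- by split => // t tI; have := is_derive_boundary tI.
- move=> t tI; rewrite derive1E.
  exact: (derive_val (is_derive := is_derive_boundary tI)).
Qed.

(* The difference of the two sides is [2 (dxi - cot_sum xi)^2]: this is
   Jacobi's completion of the square along the positive eigenfunction
   [\prod_i sin (angle i t)] of the Jacobi operator. *)
Lemma density2_ge t : t \in `]0, alpha[%R ->
  boundary' t + 2 * jacobi_eigenvalue * xi t ^+ 2 <= density2 g m0 m1 xi dxi 0 t.
Proof.
move=> tI; rewrite -subr_ge0.
have -> : density2 g m0 m1 xi dxi 0 t = 2 * dxi t ^+ 2 +
    2 * xi t ^+ 2 * \sum_(i < g) m i * (sin (angle g i t) ^- 2 - 2).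
  rewrite /density2; congr (_ + _); rewrite mulr_sumr; apply: eq_bigr => i _.
  rewrite mul0r addr0 cos2sin2.
  have : sin (angle g i t) != 0.
    by apply: sin_angle_neq0 => //; move: tI; rewrite in_itv.
  by move=> s0; field.
set Q := \sum_(i < g) m i * _; set M := \sum_(i < g) m i.
have QE : Q = (cot_sum t + log_weight' t) * cot_sum t - csc_sum t
    - 2 * M + g%:R * (g%:R + M).
  by rewrite cot_sum_identity// -/Q -/M; ring.
have -> : 2 * dxi t ^+ 2 + 2 * xi t ^+ 2 * Q -
    (boundary' t + 2 * jacobi_eigenvalue * xi t ^+ 2) =
    2 * (dxi t - cot_sum t * xi t) ^+ 2.
  by rewrite QE /boundary' /jacobi_eigenvalue -/M; ring.
by rewrite mulr_ge0// sqr_ge0.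
Qed.

(** Integrating [density2_ge] against the weight removes the boundary term and leaves the lower
    bound [q], whose integral is positive because [q] is nonnegative, continuous and positive at
    [t0]. *)
Lemma Rintegral_density2_gt0 t0 : t0 \in `]0, alpha[%R -> xi t0 != 0 ->
  0 < \int[mu]_(t in `[0, alpha]) (density2 g m0 m1 xi dxi 0 t * P t).
Proof.
move=> t0I xi0.
pose q t := 2 * jacobi_eigenvalue * xi t ^+ 2 * P t.
have cP : continuous P by exact: continuous_weight.
have cq : {within `[0, alpha], continuous q}.
  apply: continuous_subspaceT => t; apply: cvgM; last exact: cP.
  by apply: cvgM; [exact: cvg_cst|exact: cvg_xi2].
have e2 : 0 < 2 * jacobi_eigenvalue by rewrite mulr_gt0// jacobi_eigenvalue_gt0.
have q0 t : 0 <= q t.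
  by rewrite mulr_ge0 ?weight_ge0// mulr_ge0 ?sqr_ge0// ltW.
have cd2 : {within `[0, alpha], continuous
    (fun t => density2 g m0 m1 xi dxi 0 t * P t)}.
  have [C d2C] := density2_bounded m0 m1 K0 bound_K.
  apply: (@within_continuous_mul_weight _ _ _ _ g1 m0_gt0 m1_gt0 _ C).
    exact: continuous_density2.
  by move=> t tI; exact: d2C.
have integrable_within (f : R -> R) : {within `[0, alpha], continuous f} ->
    mu.-integrable `[0, alpha] (EFin \o f).
  by apply: continuous_compact_integrable; exact: segment_compact.
have ib' := integrable_within _ continuous_boundary'_weight.
have iq := integrable_within _ cq.
have qgt0 : 0 < \int[mu]_(t in `[0, alpha]) q t.
  apply: (Rintegral_gt0 cq _ t0I) => //.
  have t0J : 0 < t0 < alpha by move: t0I; rewrite in_itv.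
  by rewrite /q mulr_gt0 ?weight_gt0// mulr_gt0// exprn_even_gt0.
apply: (lt_le_trans qgt0).
have -> : \int[mu]_(t in `[0, alpha]) q t =
    \int[mu]_(t in `[0, alpha]) (boundary' t * P t + q t).
  by rewrite RintegralD// Rintegral_boundary' add0r.
apply: le_Rintegral => //.
- exact: (integrableD _ ib' iq).
- exact: integrable_within.
- move=> t; rewrite /= in_itv/= => /andP[t_ge0 t_le].
  (* At the two ends, outside the range of [density2_ge], both sides vanish with the weight. *)
  have [<-|t_neq0] := eqVneq 0 t; first by rewrite /q weight0// !mulr0 addr0.
  have [->|t_neqa] := eqVneq t alpha.
    by rewrite /q weight_step// !mulr0 addr0.
  rewrite -mulrDl ler_wpM2r ?weight_ge0// density2_ge//.
  by rewrite in_itv/= !lt_neqAle t_neq0 t_ge0 t_neqa t_le.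
Qed.

End Positivity.

(** * Harmonicity of the identity map *)

Section IdentityHarmonic.
Context {R : realType}.

Lemma is_derive_scalel (V : normedModType R) (f : R -> R) (x df : R) (v : V) :
  is_derive x 1 f df -> is_derive x 1 (fun t => f t *: v) (df *: v).
Proof.
move=> Df.
have cv : (fun h => h^-1 *: (((fun t => f t *: v) \o shift x) (h *: (1 : R)) - f x *: v))
    @ 0^' --> df *: v.
  under eq_cvg do rewrite /= -scalerBl scalerA.
  apply: cvgZr_tmp; rewrite -(derive_val (is_derive := Df)).
  exact: (ex_derive (is_derive := Df)).
by split; [apply/cvg_ex; exists (df *: v)|exact: cvg_lim].
Qed.

Variable n : nat.
Local Notation V := 'cV[R]_n.+2.

Lemma derive1n2_great_circle (x e : V) : derive1n 2 (great_circle x e) 0 = - x.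
Proof.
have D (c s : R -> R) (t dc ds : R) : is_derive t 1 c dc -> is_derive t 1 s ds ->
    derive1 (fun t => c t *: x + s t *: e) t = dc *: x + ds *: e.
  move=> Dc Ds; rewrite derive1E; apply: derive_val.
  by apply: is_deriveD; exact: is_derive_scalel.
have D1 : derive1 (great_circle x e) = (fun t => (- sin t) *: x + cos t *: e).
  by apply/funext => t; exact: D.
rewrite /derive1n /= D1 (D (fun t => - sin t) _ _ (- cos 0) (- sin 0)).
by rewrite cos0 sin0 oppr0 scale0r addr0 scaleN1r.
Qed.

Lemma smooth_map_id : smooth_map (fun x : V => x).
Proof.
move=> vs x.
(* The first directional derivative is the constant direction, and all later ones are 0. *)
have [->|[w ->]] : iter_derive vs (fun x : V => x) = id \/
    exists w, iter_derive vs (fun x : V => x) = cst w.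
- elim: vs => [|v vs [IH|[w IH]]] /=; first by left.
    by right; exists v; apply/funext => y; rewrite IH derive_id.
  by right; exists 0; apply/funext => y; rewrite IH derive_cst.
- exact: ex_diff.
- exact: differentiable_cst.
Qed.

(** The acceleration [- x] of a great circle is normal to the sphere, so each summand of the tension
    has zero tangential part. *)
Lemma harmonic_id : harmonic_self_map (fun x : V => x).
Proof.
split=> //; first by exists id => //; exact: smooth_map_id.
move=> x e xS _; apply: big1 => j _.
rewrite derive1n2_great_circle /tangential.
have -> : dot (- x) x = - 1.
  by rewrite -xS /dot -sumrN; apply: eq_bigr => i _; rewrite !mxE mulNr.
by rewrite scaleN1r opprK addNr.
Qed.

End IdentityHarmonic.

(** * Admissible triples and the conclusion *)

Lemma admissible_gt1 g m0 m1 : admissible_triple g m0 m1 -> (1 < g)%N.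
Proof.
move=> [_ _ [->//|[[->//]|]]].
by rewrite !inE => /or4P[/eqP[->]|/eqP[->]|/eqP[->]|/or4P[] /eqP[->]].
Qed.

(** The only odd value in the list is 3, always with equal multiplicities; this feeds
    [mult_reflect]. *)
Lemma admissible_parity g m0 m1 : admissible_triple g m0 m1 -> odd g -> m0 = m1.
Proof.
move=> [_ _ [->//|[[->//]|]]].
rewrite !inE => /or4P[/eqP[-> -> ->]|/eqP[-> -> ->]|/eqP[-> -> ->]|] //.
by move=> /or4P[] /eqP[-> -> ->].
Qed.

Lemma positive_second_variation_id (R : realType) (g m0 m1 : nat) (c : R) :
  (1 < g)%N -> (0 < m0)%N -> (0 < m1)%N -> (odd g -> m0 = m1) -> 0 < c ->
  positive_second_variation g m0 m1 c (fun t => t).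
Proof.
move=> g1 m0_gt0 m1_gt0 parity c0 xi [smooth_xi xi0 xi1] [t [/andP[t0 t1] xit]].
have xi_dxi (s : R) : is_derive s 1 xi (derive1 xi s).
  by rewrite derive1E; exact: derivableP (smooth_xi 0 s).
have cdxi : continuous (derive1 xi).
  by move=> s; exact/differentiable_continuous/derivable1_diffP/(smooth_xi 1).
have [K K0 bound_K] := variation_bound g1 xi_dxi cdxi xi0 xi1.
have [ex ->] := second_variation_density g1 m0_gt0 m1_gt0 xi_dxi cdxi K0 bound_K c.
split=> //; apply: mulr_gt0 => //.
apply: (Rintegral_density2_gt0 g1 m0_gt0 m1_gt0 parity xi_dxi cdxi K0 bound_K (t0 := t)) => //.
(* A point where [xi] is nonzero is interior, since [xi] vanishes at both ends. *)
rewrite in_itv/= !lt_neqAle t0 t1 !andbT; apply/andP; split.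
  by apply: contra_neq xit => <-.
by apply: contra_neq xit => ->.
Qed.

Theorem theorem1p1 (R : realType) (g m0 m1 : nat)
  (hgm : admissible_triple g m0 m1)
  (G : set 'M[R]_((orbit_dim g m0 m1).+2))
  (p v : 'cV[R]_((orbit_dim g m0 m1).+2))
  (hG : cohomogeneity_one_action G p v)
  (c : R) (hc : 0 < c) :
  equivariantly_stable_harmonic c G p v (fun x => x) (fun t => t).
Proof.
have [m0_gt0 m1_gt0 _] := hgm.
split.
- by split=> //; exists 1; rewrite mul1r.
- exact: harmonic_id.
- apply: positive_second_variation_id => //.
    exact: admissible_gt1 hgm.
  exact: admissible_parity hgm.
Qed.
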